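(* Let $k\ge1$, let $\mathcal{H}$ be a Hilbert space, let $a_1,\ldots,a_k\in B(\mathcal{H})$ be selfadjoint operators, and let $\xi_o\in\mathcal{H}$ be a unit vector. Let $\mathcal{K}$, $\Omega_0\in\mathcal{K}$ and $y_1,\ldots,y_k\in B(\mathcal{K})$ be constructed from $(\mathcal{H};a_1,\ldots,a_k;\xi_o)$ as follows: (i) $\mathcal{K}=\mathbb{C}\oplus\bigl(\bigoplus_{j=1}^k\mathcal{H}\bigr)$, $\Omega_0=1\oplus0\oplus\cdots\oplus0$, and for $1\le j\le k$, $v_j:\mathcal{H}\to\mathcal{K}$ is the isometric embedding onto the $j$-th copy of $\mathcal{H}$ in $\mathcal{K}$; (ii) $\Omega_j=v_j\xi_o$, and $w_j\in B(\mathcal{K})$ is the rank-one partial isometry $w_j\eta=\langle\eta,\Omega_0\rangle\Omega_j$, with adjoint $w_j^*\eta=\langle\eta,\Omega_j\rangle\Omega_0$, $\eta\in\mathcal{K}$; (iii) $x_j=0\oplus a_j\oplus\cdots\oplus a_j$ ($a_j$ acting on each of the $k$ copies of $\mathcal{H}$) and $y_j=w_j+x_j+w_j^*$, $1\le j\le k$. Let $\nu$ be the joint distribution of $a_1,\ldots,a_k$ with respect to the vector-state $\langle\,\cdot\,\xi_o,\xi_o\rangle$ on $B(\mathcal{H})$, and let $\mu$ be the joint distribution of $y_1,\ldots,y_k$ with respect to the vector-state $\langle\,\cdot\,\Omega_0,\Omega_0\rangle$ on $B(\mathcal{K})$. Then $\Phi(\nu)=\mu$.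
   Context: Inner products are linear in the first variable. $\mathcal{D}_{\mathrm{alg}}(k)$ is the set of linear functionals $\mu$ on the algebra of non-commutative polynomials $\mathbb{C}\langle X_1,\ldots,X_k\rangle$ with $\mu(1)=1$; the joint distribution of $x_1,\ldots,x_k$ with respect to a functional $\varphi$ is the $\mu\in\mathcal{D}_{\mathrm{alg}}(k)$ with $\mu(X_{i_1}\cdots X_{i_n})=\varphi(x_{i_1}\cdots x_{i_n})$. For $\mu\in\mathcal{D}_{\mathrm{alg}}(k)$, let $M_\mu=\sum_{n\ge1}\sum_{i_1,\ldots,i_n=1}^k\mu(X_{i_1}\cdots X_{i_n})z_{i_1}\cdots z_{i_n}$ and $\eta_\mu=M_\mu(1+M_\mu)^{-1}$, formal power series in non-commuting indeterminates $z_1,\ldots,z_k$. The map $\mu\mapsto\eta_\mu$ is a bijection from $\mathcal{D}_{\mathrm{alg}}(k)$ onto the formal power series in non-commuting $z_1,\ldots,z_k$ with zero constant term. The map $\Phi:\mathcal{D}_{\mathrm{alg}}(k)\to\mathcal{D}_{\mathrm{alg}}(k)$ is defined by letting $\Phi(\nu)$ be the unique element with $\eta_{\Phi(\nu)}=\sum_{i=1}^k z_i(1+M_\nu)z_i$. *)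

(* Defs.v *)
From HB Require Import structures.
From mathcomp Require Import all_boot all_order all_algebra sesquilinear.
From mathcomp Require Import finmap complex.
From mathcomp Require Import boolp classical_sets functions reals topology.
From mathcomp Require Import normedtype.
(* monalg's notations clash with those of mathcomp-analysis. *)
From mathcomp Require Import -(notations) monalg.
Set Implicit Arguments.
Unset Strict Implicit.
Unset Printing Implicit Defensive.
Import Order.TTheory GRing.Theory Num.Theory numFieldNormedType.Exports.
Local Open Scope classical_set_scope.
Local Open Scope ring_scope.

Section DotNorm.
Variables (C : numClosedFieldType) (V : lmodType C).
Variable f : {dot V for Num.Def.conjC}.

Lemma dot_CS u v : `|f u v| ^+ 2 <= f u u * f v v.
Proof.
have [->|v0] := eqVneq v 0; first by rewrite !linear0r normr0 expr0n /= mulr0.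
have fv : 0 < f v v by exact: neq0_dnorm_gt0.
pose a := f u v / f v v.
have := dnorm_ge0 f (u - a *: v).
have fvJ : (f v v)^* = f v v by apply/CrealP; rewrite ger0_real// ltW.
rewrite dnormB dnormZ linearZr_LR /=.
have -> : a^* * f u v = `|f u v| ^+ 2 / f v v.
  by rewrite /a rmorphM fmorphV /= fvJ mulrC mulrA normCK.
have -> : (`|f u v| ^+ 2 / f v v)^* = `|f u v| ^+ 2 / f v v.
  by apply/CrealP; rewrite ger0_real// divr_ge0 ?exprn_ge0// ltW.
have -> : `|a| ^+ 2 * f v v = `|f u v| ^+ 2 / f v v.
  rewrite /a normrM normfV (gtr0_norm fv) exprMn -mulrA; congr (_ * _).
  by rewrite expr2 -mulrA mulVf ?mulr1 // gt_eqF.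
by rewrite opprD addrA addrK subr_ge0 ler_pdivrMr.
Qed.

Lemma sqrtC_dotD u v :
  sqrtC (f (u + v) (u + v)) <= sqrtC (f u u) + sqrtC (f v v).
Proof.
have ge0 w : 0 <= f w w by exact: dnorm_ge0.
rewrite -(@ler_pXn2r _ 2) ?nnegrE ?addr_ge0 ?sqrtC_ge0 //.
rewrite sqrrD !sqrtCK dnormD [leRHS]addrAC lerD2l.
have -> : f u v + (f u v)^* = 'Re (f u v) *+ 2.
  by rewrite -mulr_natr ReE mulfVK // pnatr_eq0.
rewrite lerMn2r /=; apply: le_trans (leif_Re_Creal _).1 _.
rewrite -(@ler_pXn2r _ 2) ?nnegrE ?mulr_ge0 ?sqrtC_ge0 //.
by rewrite exprMn !sqrtCK dot_CS.
Qed.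

Lemma sqrtC_dotZ a u : sqrtC (f (a *: u) (a *: u)) = `|a| * sqrtC (f u u).
Proof. by rewrite dnormZ sqrtCM ?nnegrE ?exprn_ge0 ?dnorm_ge0 // sqrCK. Qed.

Lemma sqrtC_dot_eq0 u : sqrtC (f u u) = 0 -> u = 0.
Proof. by move/eqP; rewrite sqrtC_eq0 dnorm_eq0 => /eqP. Qed.

End DotNorm.

(* [{dot H for conjC}]: linear in the first variable, conjugate-linear in the
   second one, hermitian and positive definite. *)
HB.mixin Record NormedModule_hasInner (R : realType) H
    of NormedModule R[i] H := {
  inner : {dot H for @Num.Def.conjC R[i]} ;
  normrE_inner : forall x : H, `|x| ^+ 2 = inner x x
}.

#[short(type="hilbertType")]
HB.structure Definition Hilbert (R : realType) :=
  {H of CompleteNormedModule R[i] H & NormedModule_hasInner R H}.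

Lemma cauchy_fmap (R1 R2 : numFieldType) (T : pseudoMetricType R1)
    (U : pseudoMetricType R2) (g : T -> U) (F : set_system T) :
    (forall e : R2, 0 < e -> exists2 d : R1, 0 < d &
       forall x y, ball x d y -> ball (g x) e (g y)) ->
  ProperFilter F -> cauchy F -> cauchy (g @ F).
Proof.
move=> gU FF /cauchyP Fc; apply/cauchy_exP => e e0.
have [d d0 gd] := gU e e0; have [x Fx] := Fc d d0.
have sub : ball x d `<=` g @^-1` ball (g x) e := gd x.
by exists (g x); exact: (filterS sub Fx).
Qed.

Section ComplexComplete.
Variable R : realType.

Lemma complex_complete (F : set_system (R[i]^o)) :
  ProperFilter F -> cauchy F -> cvg F.
Proof.
move=> FF Fc.
have norm_ge_Im (z : R[i]) : `|complex.Im z|%:C%C <= `|z|.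
  rewrite normc_def lecR -(sqrtr_sqr (complex.Im z)) ler_wsqrtr //.
  by rewrite lerDr sqr_ge0.
have ReB (u v : R[i]) : complex.Re (u - v) = complex.Re u - complex.Re v.
  by case: u v => [? ?] [].
have ImB (u v : R[i]) : complex.Im (u - v) = complex.Im u - complex.Im v.
  by case: u v => [? ?] [].
have Rc (g : R[i]^o -> R) : (forall x y, `|g x - g y|%:C%C <= `|x - y|) ->
    exists l : R, g @ F --> l.
  move=> gl; apply/cvg_ex; apply: R_complete.
  apply: (@cauchy_fmap R[i] R R[i]^o R) Fc => e e0.
  exists (e%:C)%C; first by rewrite ltcR.
  move=> x y; rewrite -!ball_normE /= => xy.
  by rewrite -ltcR; apply: le_lt_trans xy.
have [a Fa] := Rc (@complex.Re R) (fun x y => ltac:(rewrite -ReB; exact: normc_ge_Re)).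
have [b Fb] := Rc (@complex.Im R) (fun x y => ltac:(rewrite -ImB; exact: norm_ge_Im)).
apply/cvg_ex; exists (a +i* b)%C.
apply/cvgrPdist_lt => e e0.
have [e' ee' e'0] : exists2 e', e = (e'%:C)%C & 0 < e'.
  case: e e0 => e1 e2; rewrite ltcE /= => /andP[/eqP -> e10].
  by exists e1.
move: Fa => /cvgrPdist_lt /(_ (e' / 2)) Fa.
move: Fb => /cvgrPdist_lt /(_ (e' / 2)) Fb.
near=> z.
have za : `|a - complex.Re z| < e' / 2.
  by near: z; apply: Fa; rewrite divr_gt0.
have zb : `|b - complex.Im z| < e' / 2.
  by near: z; apply: Fb; rewrite divr_gt0.
rewrite ee' normc_def ltcR.
rewrite ReB ImB /=.
rewrite -[ltRHS]gtr0_norm // -sqrtr_sqr ltr_sqrt ?exprn_gt0 //.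
rewrite -(real_normK (num_real (a - _))) -(real_normK (num_real (b - _))).
rewrite [e'](splitr e').
apply: (@lt_le_trans _ _ ((e' / 2) ^+ 2 + (e' / 2) ^+ 2)).
  by rewrite ltrD // ltr_pXn2r // ?nnegrE // divr_ge0 // ltW.
by rewrite sqrrD addrAC lerDl mulrn_wge0 // mulr_ge0 // divr_ge0 // ltW.
Unshelve. all: by end_near. Qed.

End ComplexComplete.

Section DirectSum.
Variables (R : realType) (k : nat) (H : hilbertType R).
Local Notation C := R[i].

(* The Hilbert space C (+) H (+) ... (+) H with k copies of H. The type is an
   alias of a product only as an lmodType: its norm is the one induced by
   [dsum_inner], not the sup norm of the product. *)
Definition dsum : Type := (C^o * {ffun 'I_k -> H})%type.

HB.instance Definition _ := GRing.Lmodule.on dsum.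

Definition dsum_inner (x y : dsum) : C :=
  x.1 * (y.1)^* + \sum_(j < k) inner (x.2 j) (y.2 j).

Fact dsum_inner_bilinear :
  bilinear_for *%R (Num.Def.conjC \; *%R) dsum_inner.
Proof.
split=> u a x y; rewrite /dsum_inner /=.
  rewrite mulrDr mulrDl -!mulrA; rewrite mulr_sumr addrACA -big_split.
  congr (_ + _); apply: eq_bigr => j _.
  by rewrite !ffunE linearPl.
rewrite rmorphD rmorphM !mulrDr mulr_sumr mulrCA addrACA -big_split.
congr (_ + _); apply: eq_bigr => j _.
by rewrite !ffunE linearPr.
Qed.

HB.instance Definition _ := bilinear_isBilinear.Build C dsum dsum C _ _
  dsum_inner dsum_inner_bilinear.

Fact dsum_inner_hermitian x y :
  dsum_inner x y = (-1) ^+ false * (dsum_inner y x)^*.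
Proof.
rewrite expr0 mul1r /dsum_inner rmorphD rmorphM /= conjCK mulrC; congr (_ + _).
rewrite rmorph_sum; apply: eq_bigr => j _.
by rewrite [LHS]hermC expr0 mul1r.
Qed.

HB.instance Definition _ := isHermitianSesquilinear.Build C dsum false
  Num.Def.conjC dsum_inner dsum_inner_hermitian.

Fact dsum_inner_gt0 u : u != 0 -> 0 < dsum_inner u u.
Proof.
have s0 : 0 <= \sum_(j < k) inner (u.2 j) (u.2 j).
  by apply: sumr_ge0 => j _; exact: dnorm_ge0.
rewrite /dsum_inner -normCK lt_def addr_ge0 ?exprn_ge0 // andbT.
apply: contra; rewrite paddr_eq0 ?exprn_ge0 // expf_eq0 /= normr_eq0.
rewrite psumr_eq0 => [/andP[/eqP u1 /allP u2]|j _]; last exact: dnorm_ge0.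
case: u s0 u1 u2 => u1 u2 /= _ -> h; apply/eqP; congr (_, _).
apply/ffunP => j; rewrite ffunE; apply/eqP.
by have := h j (mem_index_enum _); rewrite dnorm_eq0.
Qed.

HB.instance Definition _ := isDotProduct.Build C dsum dsum_inner dsum_inner_gt0.

Local Notation dsum_dot := (dsum_inner : {dot dsum for @Num.Def.conjC C}).

HB.instance Definition _ := Lmodule_isNormed.Build C dsum
  (sqrtC_dotD dsum_dot) (sqrtC_dotZ dsum_dot) (@sqrtC_dot_eq0 _ _ dsum_dot).

Lemma dsum_normE (x : dsum) : `|x| ^+ 2 = dsum_dot x x.
Proof. exact: sqrtCK. Qed.

Lemma dsum_norm_sqr (x : dsum) :
  `|x| ^+ 2 = `|x.1| ^+ 2 + \sum_(j < k) `|x.2 j| ^+ 2.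
Proof.
rewrite dsum_normE /= /dsum_inner -normCK; congr (_ + _).
by apply: eq_bigr => j _; rewrite normrE_inner.
Qed.

Lemma dsum_norm1 (x : dsum) : `|x.1| <= `|x|.
Proof.
rewrite -(@ler_pXn2r _ 2) ?nnegrE // dsum_norm_sqr lerDl.
by apply: sumr_ge0 => j _; rewrite exprn_ge0.
Qed.

Lemma dsum_norm2 (x : dsum) j : `|x.2 j| <= `|x|.
Proof.
rewrite -(@ler_pXn2r _ 2) ?nnegrE // dsum_norm_sqr (bigD1 j) //= addrCA lerDl.
by rewrite addr_ge0 ?exprn_ge0 ?sumr_ge0 // => i _; rewrite exprn_ge0.
Qed.

Lemma dsum_norm_le (x : dsum) : `|x| <= `|x.1| + \sum_(j < k) `|x.2 j|.
Proof.
have s0 (P : pred 'I_k) : 0 <= \sum_(j < k | P j) `|x.2 j|.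
  by apply: sumr_ge0 => j _.
rewrite -(@ler_pXn2r _ 2) ?nnegrE ?addr_ge0 // dsum_norm_sqr sqrrD -addrA lerD2l.
apply: (@le_trans _ _ ((\sum_(j < k) `|x.2 j|) ^+ 2)); last first.
  by rewrite lerDr mulrn_wge0 // mulr_ge0.
rewrite [leRHS]expr2 mulr_suml ler_sum // => j _.
by rewrite expr2 ler_wpM2l // (bigD1 j) //= lerDl.
Qed.

Lemma dsum_complete (F : set_system dsum) :
  ProperFilter F -> cauchy F -> cvg F.
Proof.
move=> FF Fc.
have [a Fa] : exists l : C^o, (fun x : dsum => x.1) @ F --> l.
  apply/cvg_ex; apply: complex_complete.
  apply: (@cauchy_fmap C C dsum C^o) Fc => e e0; exists e => // x y.
  by rewrite -!ball_normE /=; apply: le_lt_trans; exact: (dsum_norm1 (x - y)).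
have /choice[b Fb] : forall j, exists l : H, (fun x : dsum => x.2 j) @ F --> l.
  move=> j; apply/cvg_ex; apply: cauchy_cvg.
  apply: (@cauchy_fmap C C dsum H) Fc => e e0; exists e => // x y.
  rewrite -!ball_normE /=; apply: le_lt_trans.
  by have := dsum_norm2 (x - y) j; rewrite /= !ffunE.
apply/cvg_ex; exists ((a, [ffun j => b j]) : dsum).
apply/cvgrPdist_lt => e e0.
have d0 : 0 < e / k.+1%:R by rewrite divr_gt0.
move: Fa => /cvgrPdist_lt /(_ _ d0) Fa.
have {}Fb : \forall x \near F, forall j, `|b j - (x : dsum).2 j| < e / k.+1%:R.
  by apply: filter_forall => j; move: (Fb j) => /cvgrPdist_lt /(_ _ d0).
near=> x.
apply: le_lt_trans (dsum_norm_le _) _ => /=.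
have -> : e = e / k.+1%:R + \sum_(j < k) e / k.+1%:R.
  by rewrite sumr_const card_ord -mulrS -(mulr_natr (e / _)) mulfVK ?pnatr_eq0 //.
apply: ltr_leD; first by near: x.
apply: ler_sum => j _; rewrite !ffunE ltW //.
by move: j; near: x.
Unshelve. all: by end_near. Qed.

HB.instance Definition _ := Uniform_isComplete.Build dsum dsum_complete.
HB.instance Definition _ := NormedModule_hasInner.Build R dsum dsum_normE.

End DirectSum.

Section BoundedOperators.
Variables (R : realType) (H : hilbertType R).
Local Notation C := R[i].

Definition bounded_linear : {pred H -> H} := [pred f |
  `[< linear f /\ exists M : C, forall x, `|f x| <= M * `|x| >]].

Lemma bounded_linearP f : reflect
  (linear f /\ exists M : C, forall x, `|f x| <= M * `|x|)
  (f \in bounded_linear).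
Proof. by rewrite inE; exact: asboolP. Qed.

Fact bounded_linear_submod : submod_closed bounded_linear.
Proof.
split=> [|a f g /bounded_linearP[lf [M fM]] /bounded_linearP[lg [N gN]]].
  apply/bounded_linearP; split=> [a x y|]; first by rewrite scaler0 addr0.
  by exists 0 => x; rewrite mul0r normr0.
apply/bounded_linearP; split=> [b x y|].
  change (a *: f (b *: x + y) + g (b *: x + y) =
    b *: (a *: f x + g x) + (a *: f y + g y)).
  by rewrite lf lg !scalerDr !scalerA mulrC addrACA.
exists (`|a| * M + N) => x; rewrite mulrDl -mulrA.
apply: le_trans (ler_normD _ _) _; rewrite lerD //.
by rewrite normrZ ler_wpM2l.
Qed.

HB.instance Definition _ := GRing.isSubmodClosed.Build C (H -> H)
  bounded_linear bounded_linear_submod.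

(* B(H), an algebra with composition as its product. It is only a pzRingType:
   1 = 0 when H is trivial. *)
Record bop := Bop { bop_fun :> H -> H ; _ : bop_fun \in bounded_linear }.

HB.instance Definition _ := [isSub for bop_fun].
HB.instance Definition _ := [Choice of bop by <:].
HB.instance Definition _ := [SubChoice_isSubLmodule of bop by <:].

Lemma bopP (a b : bop) : a =1 b -> a = b.
Proof. by move=> ab; apply: val_inj; apply/funext. Qed.

Lemma bopE (a b : bop) (c : C) x :
  ((a + b) x = a x + b x) * ((c *: a) x = c *: a x) *
  ((- a) x = - a x) * ((0 : bop) x = 0).
Proof. by []. Qed.

Lemma bop_linear (a : bop) : linear a.
Proof. by have /bounded_linearP[] := valP a. Qed.

HB.instance Definition _ (a : bop) :=
  GRing.isLinear.Build C H H *:%R a (bop_linear a).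

Fact bop_id_subproof : idfun \in bounded_linear.
Proof. by apply/bounded_linearP; split=> //; exists 1 => x; rewrite mul1r. Qed.

Definition bop_id := Bop bop_id_subproof.

Fact bop_comp_subproof (a b : bop) : a \o b \in bounded_linear.
Proof.
have /bounded_linearP[la [M aM]] := valP a.
have /bounded_linearP[lb [N bN]] := valP b.
apply/bounded_linearP; split=> [c x y|]; first by rewrite /= lb la.
exists (`|M| * N) => x /=; apply: le_trans (aM _) _.
apply: (@le_trans _ _ (`|M| * `|b x|)); last first.
  by rewrite -mulrA ler_wpM2l.
have [->|bx0] := eqVneq (b x) 0; first by rewrite normr0 !mulr0.
have Mge0 : 0 <= M.
  have := le_trans (normr_ge0 _) (aM (b x)).
  by rewrite pmulr_lge0 // normr_gt0.
by rewrite ger0_norm.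
Qed.

Definition bop_comp a b := Bop (bop_comp_subproof a b).

Fact bop_compA : associative bop_comp. Proof. by move=> a b c; exact: bopP. Qed.
Fact bop_comp1l : left_id bop_id bop_comp. Proof. by move=> a; exact: bopP. Qed.
Fact bop_comp1r : right_id bop_id bop_comp. Proof. by move=> a; exact: bopP. Qed.
Fact bop_compDl : left_distributive bop_comp +%R.
Proof. by move=> a b c; exact: bopP. Qed.
Fact bop_compDr : right_distributive bop_comp +%R.
Proof. by move=> a b c; apply: bopP => x /=; rewrite linearD. Qed.

HB.instance Definition _ := GRing.Zmodule_isPzRing.Build bop
  bop_compA bop_comp1l bop_comp1r bop_compDl bop_compDr.

Lemma bopM (a b : bop) x : (a * b) x = a (b x). Proof. by []. Qed.
Lemma bop1 x : (1 : bop) x = x. Proof. by []. Qed.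

Definition adjoint_pair (a b : bop) :=
  forall x y, inner (a x) y = inner x (b y).

Definition selfadjoint (a : bop) := adjoint_pair a a.

Lemma inner_le (x y : H) : `|inner x y| <= `|x| * `|y|.
Proof.
rewrite -(@ler_pXn2r _ 2) ?nnegrE ?mulr_ge0 // exprMn !normrE_inner.
exact: dot_CS.
Qed.

Fact rank1_subproof (u v : H) :
  (fun x : H => inner x v *: u) \in bounded_linear.
Proof.
apply/bounded_linearP; split=> [c x y|].
  by rewrite linearPl scalerDl scalerA.
exists (`|v| * `|u|) => x; rewrite normrZ mulrAC ler_wpM2r //.
by rewrite mulrC inner_le.
Qed.

(* x |-> <x, v> u *)
Definition rank1 u v : bop := Bop (rank1_subproof u v).

Lemma rank1_adjoint u v : adjoint_pair (rank1 u v) (rank1 v u).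
Proof.
move=> x y /=; rewrite linearZl_LR linearZr_LR /=.
by rewrite (hermC _ u y) expr0 mul1r mulrC.
Qed.

Fact vstate_scalar (xi : H) : scalar (fun a : bop => inner (a xi) xi).
Proof. by move=> c a b; exact: (linearPl inner xi c (a xi) (b xi)). Qed.

Definition vstate_fun (xi : H) (a : bop) : C := inner (a xi) xi.

HB.instance Definition _ (xi : H) :=
  GRing.isLinear.Build C bop C *%R (vstate_fun xi) (vstate_scalar xi).

Definition vstate (xi : H) : {scalar bop} := vstate_fun xi.

Lemma vstate1 (xi : H) : `|xi| = 1 -> vstate xi 1 = 1.
Proof. by move=> xi1; rewrite /= /vstate_fun bop1 -normrE_inner xi1 expr1n. Qed.

End BoundedOperators.

Section Construction.
Variables (R : realType) (k : nat) (H : hilbertType R).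
Local Notation C := R[i].
Local Notation K := (dsum k H).

(* Omega_0 *)
Definition vac : K := (1, 0).

(* v_j *)
Definition embed (j : 'I_k) (x : H) : K :=
  (0, [ffun i => if i == j then x else 0]).

(* x |-> 0 (+) a (+) ... (+) a applied to x *)
Fact inflate_subproof (a : bop H) :
  (fun x : K => (0, [ffun i => a (x.2 i)]) : K) \in @bounded_linear R K.
Proof.
have /bounded_linearP[la [M aM]] := valP a.
apply/bounded_linearP; split=> [c x y|].
  congr (_, _); first by rewrite -[RHS]/(c *: (0 : C^o) + 0) scaler0 addr0.
  by apply/ffunP => i; rewrite !ffunE la.
exists `|M| => x; rewrite -(@ler_pXn2r _ 2) ?nnegrE ?mulr_ge0 //.
rewrite exprMn !dsum_norm_sqr /= normr0 expr0n add0r mulrDr mulr_sumr.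
rewrite -[leLHS]add0r lerD ?mulr_ge0 ?exprn_ge0 //.
apply: ler_sum => i _; rewrite ffunE -exprMn ler_pXn2r ?nnegrE ?mulr_ge0 //.
apply: le_trans (aM _) _.
have [->|x0] := eqVneq (x.2 i) 0; first by rewrite normr0 !mulr0.
have Mge0 : 0 <= M.
  have := le_trans (normr_ge0 _) (aM (x.2 i)).
  by rewrite pmulr_lge0 // normr_gt0.
by rewrite ger0_norm.
Qed.

Definition inflate (a : bop H) : bop K := Bop (inflate_subproof a).

(* w_j and its adjoint w_j^*; here [embed j xi] is Omega_j. *)
Definition wop (xi : H) (j : 'I_k) : bop K := rank1 (embed j xi) vac.
Definition wadj (xi : H) (j : 'I_k) : bop K := rank1 vac (embed j xi).

Lemma wop_adjoint xi j : adjoint_pair (wop xi j) (wadj xi j).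
Proof. exact: rank1_adjoint. Qed.

Definition yop (a : 'I_k -> bop H) (xi : H) (j : 'I_k) : bop K :=
  wop xi j + inflate (a j) + wadj xi j.

Lemma vac_norm1 : `|vac| = 1.
Proof.
apply/eqP; rewrite -(@eqrXn2 _ 2) // expr1n dsum_norm_sqr normr1 expr1n.
by rewrite big1 ?addr0 // => j _; rewrite ffunE normr0 expr0n.
Qed.

Lemma embed_isometry j x : `|embed j x| = `|x|.
Proof.
apply/eqP; rewrite -(@eqrXn2 _ 2) // dsum_norm_sqr normr0 expr0n add0r.
rewrite (bigD1 j) //= big1 => [|i ij]; rewrite ffunE ?eqxx ?addr0 //.
by rewrite (negPf ij) normr0 expr0n.
Qed.

End Construction.

Section FormalSeries.
Variables (F : fieldType) (k : nat).

(* Formal power series in noncommuting indeterminates z_i, i < k: [coef f w] is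
   the coefficient of f at z_(w_1) ... z_(w_n), and the product is the
   convolution along concatenation of words. The units of this ring are the
   series with a nonzero constant term. *)
Record ncps := NCPS { coef : seq 'I_k -> F }.

HB.instance Definition _ := [isNew for coef].
HB.instance Definition _ := [Choice of ncps by <:].

Implicit Types (f g h : ncps) (w : seq 'I_k).

Lemma ncpsP f g : coef f =1 coef g -> f = g.
Proof. by move=> fg; apply: val_inj; apply/funext. Qed.

Definition ncps_zero := NCPS (fun=> 0).
Definition ncps_opp f := NCPS (fun w => - coef f w).
Definition ncps_add f g := NCPS (fun w => coef f w + coef g w).

Fact ncps_addA : associative ncps_add.
Proof. by move=> f g h; apply: ncpsP => w; exact: addrA. Qed.
Fact ncps_addC : commutative ncps_add.
Proof. by move=> f g; apply: ncpsP => w; exact: addrC. Qed.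
Fact ncps_add0 : left_id ncps_zero ncps_add.
Proof. by move=> f; apply: ncpsP => w; exact: add0r. Qed.
Fact ncps_addN : left_inverse ncps_zero ncps_opp ncps_add.
Proof. by move=> f; apply: ncpsP => w; exact: addNr. Qed.

HB.instance Definition _ := GRing.isZmodule.Build ncps
  ncps_addA ncps_addC ncps_add0 ncps_addN.

Definition ncps_one := NCPS (fun w => (w == [::])%:R).

Definition ncps_mul f g := NCPS (fun w =>
  \sum_(i < (size w).+1) coef f (take i w) * coef g (drop i w)).

Definition ncps_shift (a : 'I_k) f := NCPS (fun w => coef f (a :: w)).

Lemma ncps_mul_nil f g : coef (ncps_mul f g) [::] = coef f [::] * coef g [::].
Proof. by rewrite /= big_ord1. Qed.

Lemma ncps_mul_cons f g a w : coef (ncps_mul f g) (a :: w) =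
  coef f [::] * coef g (a :: w) + coef (ncps_mul (ncps_shift a f) g) w.
Proof. by rewrite [LHS]big_ord_recl. Qed.

Lemma eq_ncps_mul f g f' g' w :
  (forall v, (size v <= size w)%N -> coef f v = coef f' v) ->
  (forall v, (size v <= size w)%N -> coef g v = coef g' v) ->
  coef (ncps_mul f g) w = coef (ncps_mul f' g') w.
Proof.
move=> ff' gg' /=; apply: eq_bigr => i _.
by rewrite ff' ?size_take_min ?geq_minr// gg' ?size_drop ?leq_subr.
Qed.

Fact ncps_mulDl : left_distributive ncps_mul +%R.
Proof.
move=> f g h; apply: ncpsP => w /=; rewrite -big_split /=.
by apply: eq_bigr => i _; rewrite mulrDl.
Qed.
Fact ncps_mulDr : right_distributive ncps_mul +%R.
Proof.
move=> f g h; apply: ncpsP => w /=; rewrite -big_split /=.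
by apply: eq_bigr => i _; rewrite mulrDr.
Qed.

Lemma ncps_mulZl c f g w :
  coef (ncps_mul (NCPS (fun v => c * coef f v)) g) w =
  c * coef (ncps_mul f g) w.
Proof. by rewrite /= mulr_sumr; apply: eq_bigr => i _; rewrite mulrA. Qed.

Fact ncps_mulA : associative ncps_mul.
Proof.
move=> f g h; apply: ncpsP => w.
elim: w f => [|a w IH] f; first by rewrite !ncps_mul_nil mulrA.
rewrite ncps_mul_cons [RHS]ncps_mul_cons IH ncps_mul_nil -mulrA.
rewrite ncps_mul_cons mulrDr -addrA; congr (_ + _).
have -> : ncps_shift a (ncps_mul f g) =
    NCPS (fun v => coef f [::] * coef (ncps_shift a g) v)
    + ncps_mul (ncps_shift a f) g.
  by apply: ncpsP => v; rewrite [LHS]ncps_mul_cons.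
by rewrite ncps_mulDl -ncps_mulZl.
Qed.

Fact ncps_mul1 : left_id ncps_one ncps_mul.
Proof.
move=> f; apply: ncpsP => w; rewrite [LHS]big_ord_recl /= take0 drop0 mul1r.
by rewrite big1 ?addr0 // => i _; case: w i => [[]//|a w i] /=; rewrite mul0r.
Qed.
Fact ncps_mulr1 : right_id ncps_one ncps_mul.
Proof.
move=> f; apply: ncpsP => w; rewrite [LHS]big_ord_recr /=.
rewrite take_size drop_size mulr1 big1 ?add0r // => i _.
by rewrite -size_eq0 size_drop subn_eq0 leqNgt ltn_ord mulr0.
Qed.
Fact ncps_oner_neq0 : ncps_one != 0.
Proof.
apply/eqP => /(congr1 (fun f => coef f [::])) /eqP.
by rewrite /= oner_eq0.
Qed.

HB.instance Definition _ := GRing.Zmodule_isNzRing.Build ncps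
  ncps_mulA ncps_mul1 ncps_mulr1 ncps_mulDl ncps_mulDr ncps_oner_neq0.

Lemma coefD f g w : coef (f + g) w = coef f w + coef g w. Proof. by []. Qed.
Lemma coefN f w : coef (- f) w = - coef f w. Proof. by []. Qed.
Lemma coef1 w : coef 1 w = (w == [::])%:R. Proof. by []. Qed.
Lemma coefM f g w : coef (f * g) w =
  \sum_(i < (size w).+1) coef f (take i w) * coef g (drop i w).
Proof. by []. Qed.
Lemma coefM_nil f g : coef (f * g) [::] = coef f [::] * coef g [::].
Proof. exact: ncps_mul_nil. Qed.
Lemma coef_sum I (r : seq I) (P : pred I) (E : I -> ncps) w :
  coef (\sum_(i <- r | P i) E i) w = \sum_(i <- r | P i) coef (E i) w.
Proof. by elim/big_rec2: _ => // i x y _ <-. Qed.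

(* The equation f * g = 1 determines the coefficients of g by recursion on the
   length of the word; [n] bounds that length. *)
Fixpoint ncps_inv_rec f (n : nat) (w : seq 'I_k) : F :=
  if w is a :: v then
    if n is m.+1 then
      - (coef f [::])^-1
        * coef (ncps_mul (ncps_shift a f) (NCPS (ncps_inv_rec f m))) v
    else 0
  else (coef f [::])^-1.

Definition ncps_unit : {pred ncps} := [pred f | coef f [::] != 0].

Definition ncps_inv f :=
  if f \in ncps_unit then NCPS (fun w => ncps_inv_rec f (size w) w) else f.

Lemma ncps_inv_rec_stable f n m w : (size w <= n)%N -> (size w <= m)%N ->
  ncps_inv_rec f n w = ncps_inv_rec f m w.
Proof.
elim: n m w => [|n IH] [|m] [|a w] wn wm; try by [].
apply: (congr1 (fun z => - (coef f [::])^-1 * z)).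
by apply: eq_ncps_mul => v vw //=; apply: IH; apply: leq_trans vw _.
Qed.

Lemma ncps_mulrV : {in ncps_unit, right_inverse 1 ncps_inv *%R}.
Proof.
move=> f fU; apply: ncpsP => w; rewrite /ncps_inv fU.
have f0 : coef f [::] != 0 by [].
case: w => [|a w]; first by rewrite coefM_nil /= mulfV.
rewrite [LHS]ncps_mul_cons; set X := coef (NCPS _) _.
have -> : X = - (coef f [::])^-1 * coef (ncps_mul (ncps_shift a f)
  (NCPS (ncps_inv_rec f (size w)))) w by [].
rewrite mulrA mulrN mulfV // mulN1r; apply/eqP.
rewrite addrC subr_eq0; apply/eqP.
by apply: eq_ncps_mul => v vw //=; apply: ncps_inv_rec_stable.
Qed.

Lemma ncps_unitV : {in ncps_unit, forall f, ncps_inv f \in ncps_unit}.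
Proof.
by move=> f fU; rewrite /ncps_inv fU inE /= invr_eq0.
Qed.

Fact ncps_mulVr : {in ncps_unit, left_inverse 1 ncps_inv *%R}.
Proof.
move=> f fU; have gU := ncps_unitV fU.
have e : f = ncps_inv (ncps_inv f).
  by rewrite -[LHS]mulr1 -(ncps_mulrV gU) mulrA (ncps_mulrV fU) mul1r.
by rewrite [X in _ * X]e ncps_mulrV.
Qed.

Fact ncps_unitP f g : g * f = 1 /\ f * g = 1 -> f \in ncps_unit.
Proof.
move=> [_ /(congr1 (fun h => coef h [::]))]; rewrite coefM_nil coef1 /= => e.
by apply/eqP => f0; move/eqP: e; rewrite f0 mul0r eq_sym oner_eq0.
Qed.

Fact ncps_invr_out : {in [predC ncps_unit], ncps_inv =1 id}.
Proof. by move=> f /negbTE fU; rewrite /ncps_inv fU. Qed.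

HB.instance Definition _ := GRing.NzRing_hasMulInverse.Build ncps
  ncps_mulVr ncps_mulrV ncps_unitP ncps_invr_out.

Lemma ncps_unitE f : (f \is a GRing.unit) = (coef f [::] != 0).
Proof. by []. Qed.

Definition zvar (i : 'I_k) : ncps := NCPS (fun w => (w == [:: i])%:R).

End FormalSeries.

Section AlgebraicDistributions.
Variables (F : fieldType) (k : nat).

(* The algebra of the free monoid on k letters, i.e. F<X_1, ..., X_k>. *)
Definition ncpoly := malg (fmonom 'I_k) F.

HB.instance Definition _ := GRing.Lmodule.on ncpoly.
HB.instance Definition _ := GRing.NzRing.on ncpoly.

Definition Xvar (i : 'I_k) : ncpoly := mkmalgU (fmu i) 1.

Record dalg := Dalg { dalg_fun :> {scalar ncpoly} ; _ : dalg_fun 1 = 1 }.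

Lemma dalg1 (mu : dalg) : mu 1 = 1. Proof. by case: mu. Qed.

Lemma prod_XvarE (w : seq 'I_k) :
  \prod_(i <- w) Xvar i = mkmalgU (FMonom w) 1 :> ncpoly.
Proof.
elim: w => [|i w IH]; first by rewrite big_nil -fmE.
rewrite big_cons IH [LHS]fgmulUU mulr1; congr (mkmalgU _ _).
by apply: val_inj; rewrite [LHS]fmM fmU.
Qed.

Lemma dalgP (mu nu : dalg) :
  (forall w, mu (\prod_(i <- w) Xvar i) = nu (\prod_(i <- w) Xvar i)) ->
  mu = nu.
Proof.
move=> mn; have {mn} mnE : mu =1 nu.
  move=> p; rewrite (monalgE p) !linear_sum; apply: eq_bigr => m _.
  have -> : mkmalgU m (mcoeff m p) =
      mcoeff m p *: (mkmalgU m 1 : ncpoly) :> ncpoly.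
    apply/malgP => m'; rewrite mcoeffZ !mcoeffU.
    by case: eqP; rewrite ?mulr1 ?mulr0.
  by rewrite !linearZ_LR /=; case: m => w; rewrite -prod_XvarE mn.
case: mu nu mnE => [mu mu1] [nu nu1] /= mnE.
have {}mnE : mu = nu.
  case: mu nu mnE {mu1 nu1} => [mu cmu] [nu cnu] /= /funext mnE.
  rewrite -{}mnE in cnu *; congr GRing.Linear.Pack.
  case: cmu cnu => [[m1] [m2]] [[n1] [n2]].
  by rewrite (Prop_irrelevance m1 n1) (Prop_irrelevance m2 n2).
by rewrite -{}mnE in nu1 *; congr Dalg; exact: Prop_irrelevance.
Qed.

(* The linear functional with prescribed values on the monomials. *)
Section Extension.
Variable c : seq 'I_k -> F.

Definition dalg_ext (p : ncpoly) : F := \sum_(m <- msupp p) mcoeff m p * c m.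

Lemma dalg_extU w : dalg_ext (mkmalgU (FMonom w) 1) = c w.
Proof. by rewrite [LHS](@mmapU _ _ F idfun) mul1r. Qed.

Fact dalg_ext_scalar : scalar dalg_ext.
Proof.
move=> a p q; rewrite [LHS](@mmapD _ _ F idfun); congr (_ + _).
rewrite [LHS](@mmapEw _ _ F idfun _ _ _ (msuppZ_le _ _)) mulr_sumr.
by apply: eq_bigr => m _; rewrite /= mcoeffZ mulrA.
Qed.

HB.instance Definition _ :=
  GRing.isLinear.Build F ncpoly F *%R dalg_ext dalg_ext_scalar.

Hypothesis c1 : c [::] = 1.

Fact dalg_ext1 : dalg_ext 1 = 1.
Proof.
have -> : 1 = mkmalgU (FMonom [::]) 1 :> ncpoly by rewrite -prod_XvarE big_nil.
by rewrite [LHS]dalg_extU.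
Qed.

Definition dalg_of : dalg := @Dalg dalg_ext dalg_ext1.

Lemma dalg_ofE w : dalg_of (\prod_(i <- w) Xvar i) = c w.
Proof. by rewrite prod_XvarE [LHS]dalg_extU. Qed.

End Extension.

Implicit Types mu nu : dalg.
Local Notation ncps := (ncps F k).

Definition Mseries mu : ncps :=
  NCPS (fun w => if w is [::] then 0 else mu (\prod_(i <- w) Xvar i)).

Definition eta mu : ncps := Mseries mu / (1 + Mseries mu).

Lemma Mseries_unit mu : 1 + Mseries mu \is a GRing.unit.
Proof. by rewrite ncps_unitE coefD coef1 /= addr0 oner_neq0. Qed.

Lemma etaE mu : eta mu = 1 - (1 + Mseries mu)^-1.
Proof.
by rewrite /eta -{1}[Mseries mu](addrK 1) [_ + 1]addrC mulrBl divrr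
  ?mul1r ?Mseries_unit.
Qed.

(* By [eta_inj] and [eta_surj], eta is a bijection onto the series with zero
   constant term. *)
Lemma eta_inj : injective eta.
Proof.
move=> mu nu; rewrite !etaE => /addrI /oppr_inj /invr_inj /addrI mn.
apply: dalgP => -[|i w]; first by rewrite !big_nil !dalg1.
by have := congr1 (fun h => coef h (i :: w)) mn.
Qed.

Lemma eta_surj (f : ncps) : coef f [::] = 0 -> exists mu, eta mu = f.
Proof.
move=> f0; have gU : 1 - f \is a GRing.unit.
  by rewrite ncps_unitE coefD coefN f0 coef1 subr0 oner_neq0.
have c1 : coef (1 - f)^-1 [::] = 1.
  have := congr1 (fun h => coef h [::]) (mulrV gU).
  by rewrite coefM_nil coefD coefN f0 coef1 subr0 mul1r.
exists (dalg_of c1); rewrite etaE.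
have -> : 1 + Mseries (dalg_of c1) = (1 - f)^-1.
  apply: ncpsP => -[|i w]; first by rewrite coefD coef1 addr0 c1.
  by rewrite coefD coef1 add0r [LHS]dalg_ofE.
by rewrite invrK opprB addrCA subrr addr0.
Qed.

Definition Phi_eta nu : ncps :=
  \sum_(i < k) zvar F i * (1 + Mseries nu) * zvar F i.

Fact Phi_exists nu : exists mu, eta mu = Phi_eta nu.
Proof.
apply: eta_surj; rewrite coef_sum big1 // => i _.
by rewrite !coefM_nil mulr0.
Qed.

Definition Phi nu : dalg := sval (cid (Phi_exists nu)).

Lemma PhiP nu mu : eta mu = Phi_eta nu <-> mu = Phi nu.
Proof.
have PhiE : eta (Phi nu) = Phi_eta nu by exact: (svalP (cid (Phi_exists nu))).
by split=> [|->//]; rewrite -PhiE => /eta_inj.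
Qed.

End AlgebraicDistributions.

Section JointDistribution.
Variables (R : realType) (H : hilbertType R) (k : nat).
Variables (phi : {scalar bop H}) (phi1 : phi 1 = 1) (x : 'I_k -> bop H).

Fact joint_dist_subproof : phi (\prod_(i <- [::]) x i) = 1.
Proof. by rewrite big_nil. Qed.

Definition joint_dist : dalg R[i] k :=
  dalg_of (c := fun w => phi (\prod_(i <- w) x i)) joint_dist_subproof.

Lemma joint_distE w :
  joint_dist (\prod_(i <- w) Xvar R[i] i) = phi (\prod_(i <- w) x i).
Proof. exact: dalg_ofE. Qed.

End JointDistribution.

(* Main.v *)
(** With [m u = <y_u Omega_0, Omega_0>] and
    [F_(i,x) u = <y_u (v_i x), Omega_0>], viewed as series in the word [u],
    reading words from the right (the last letter acts first) and using
    [y_j Omega_0 = Omega_j] and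
    [y_j (v_i x) = v_i (a_j x) + delta_(i j) <x, xi> Omega_0] gives
    [m = 1 + \sum_i F_(i,xi) z_i] and [F_(i,x) = m z_i G_x], where
    [G_x s = <a_s x, xi>]. Since [G_xi = 1 + M_nu], this yields
    [m = 1 + m * Phi_eta nu], that is [eta_mu = 1 - m^-1 = Phi_eta nu]. *)

Require Import Defs.
From mathcomp Require Import all_boot all_order all_algebra.
From mathcomp Require Import reals complex.
(* [Defs] again, so that its [coefM], [coefD], ... shadow those of [poly]. *)
Import GRing.Theory Num.Theory Defs.
Local Open Scope ring_scope.

Section Series.
Variables (F : fieldType) (k : nat).
Implicit Types (f g : ncps F k) (u : seq 'I_k).

(** Counterpart of [ncps_mul_cons] for peeling off the last letter, the one whose operator acts
    first. *)
Lemma coefM_rcons f g u j : coef (f * g) (rcons u j) =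
  coef (f * NCPS (fun v => coef g (rcons v j))) u
  + coef f (rcons u j) * coef g [::].
Proof.
rewrite !coefM size_rcons big_ord_recr /= -(size_rcons u j) take_size drop_size.
congr (_ + _); rewrite size_rcons; apply: eq_bigr => i _.
have iu : (i <= size u)%N by rewrite -ltnS.
by rewrite drop_rcons // -cats1 takel_cat.
Qed.

Lemma coef_mulz_nil f i : coef (f * zvar F i) [::] = 0.
Proof. by rewrite coefM_nil mulr0. Qed.

Lemma coef_mulz_rcons f i u j :
  coef (f * zvar F i) (rcons u j) = coef f u * (j == i)%:R.
Proof.
rewrite coefM_rcons mulr0 addr0 coefM big_ord_recr /= take_size drop_size.
rewrite /= eqseq_cons andbT big1 ?add0r // => l _.
(* As [l < size u], at least two letters remain on the right, and [zvar F i] vanishes there. *)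
case E: (drop l u) => [|b v] /=.
  by have := size_drop l u; rewrite E => /esym/eqP; rewrite subn_eq0 leqNgt ltn_ord.
by rewrite eqseq_cons -size_eq0 size_rcons andbF mulr0.
Qed.

End Series.

Section Moments.
Variables (R : realType) (k : nat) (H : hilbertType R).
Variables (a : 'I_k -> bop H) (xi : H).
Local Notation K := (dsum k H).
Local Notation y := (yop a xi).

Lemma dsum_innerE (u v : K) :
  inner u v = u.1 * (v.1)^* + \sum_(j < k) inner (u.2 j) (v.2 j).
Proof. by []. Qed.

Lemma inner_vac (u : K) : inner u (vac k H) = u.1.
Proof.
rewrite dsum_innerE conjC1 mulr1 big1 ?addr0 // => j _.
by rewrite ffunE linear0r.
Qed.

Lemma inner_embed (u : K) j x : inner u (embed j x) = inner (u.2 j) x.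
Proof.
rewrite dsum_innerE conjC0 mulr0 add0r (bigD1 j) //= ffunE eqxx.
by rewrite big1 ?addr0 // => i ij; rewrite ffunE (negPf ij) linear0r.
Qed.

Lemma yopE j (u : K) : y j u =
  u.1 *: embed j xi + inflate k (a j) u + inner (u.2 j) xi *: vac k H.
Proof. by rewrite -inner_embed -inner_vac. Qed.

Lemma inflate_embed i j x :
  inflate k (a j) (embed i x) = embed i (a j x).
Proof.
congr (_, _); apply/ffunP => l; rewrite !ffunE.
by case: eqP => // _; rewrite linear0.
Qed.

Lemma yop_vac j : y j (vac k H) = embed j xi.
Proof.
rewrite yopE scale1r ffunE linear0l scale0r addr0.
(* [inflate] kills the vacuum, whose components in the copies of [H] are all 0. *)
rewrite -[RHS]addr0; congr (_ + _); congr (_, _).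
by apply/ffunP => l; rewrite !ffunE linear0.
Qed.

Lemma yop_embed i j x :
  y j (embed i x) = embed i (a j x) + (inner x xi * (j == i)%:R) *: vac k H.
Proof.
rewrite yopE scale0r add0r inflate_embed ffunE.
by case: eqP => _; rewrite ?mulr1 // linear0l mulr0.
Qed.

Definition vac_series : ncps R[i] k :=
  NCPS (fun u => vstate (vac k H) (\prod_(j <- u) y j)).

Definition embed_series i x : ncps R[i] k :=
  NCPS (fun u => inner ((\prod_(j <- u) y j) (embed i x)) (vac k H)).

Definition mixed_series x : ncps R[i] k :=
  NCPS (fun u => inner ((\prod_(j <- u) a j) x) xi).

(** Each splitting [u = p i s] contributes one term: [s] acts inside the [i]-th copy of [H], the
    letter [i] drops to the vacuum with weight [<a_s x, xi>], and [p] starts afresh from there. *)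
Lemma embed_seriesE i x :
  embed_series i x = vac_series * zvar R[i] i * mixed_series x.
Proof.
apply: ncpsP => u; elim/last_ind: u x => [|u j IH] x.
  by rewrite coefM_nil coef_mulz_nil mul0r /= big_nil bop1 inner_vac.
rewrite coefM_rcons coef_mulz_rcons.
(* Removing the last letter replaces [x] by [a j x], so the induction must range over all
   vectors. *)
have -> : NCPS (fun v => coef (mixed_series x) (rcons v j))
    = mixed_series (a j x).
  by apply: ncpsP => v; rewrite /= big_rcons.
rewrite -IH /= !big_rcons big_nil bop1 bopM yop_embed linearD linearZ /=.
rewrite linearDl linearZl_LR /=; congr (_ + _).
by rewrite [RHS]mulrC mulrCA mulrC.
Qed.

Lemma vac_seriesE :
  vac_series = 1 + \sum_(i < k) embed_series i xi * zvar R[i] i.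
Proof.
apply: ncpsP => u; rewrite coefD coef1 coef_sum.
case/lastP: u => [|u j].
  rewrite big1 => [|i _]; last exact: coef_mulz_nil.
  by rewrite /= big_nil addr0 vstate1 // vac_norm1.
rewrite -size_eq0 size_rcons add0r (bigD1 j) // coef_mulz_rcons eqxx mulr1.
rewrite big1 => [|i ij]; last by rewrite coef_mulz_rcons eq_sym (negPf ij) mulr0.
by rewrite /= addr0 /vstate_fun big_rcons bopM yop_vac.
Qed.

End Moments.

Arguments vac_series {R k H}.
Arguments mixed_series {R k H}.

Theorem theorem7p5 (R : realType) (k : nat) (k_gt0 : (1 <= k)%N)
    (H : hilbertType R) (a : 'I_k -> bop H)
    (a_sa : forall j : 'I_k, selfadjoint (a j))
    (xi : H) (xi_unit : `|xi| = 1) :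
  let nu := joint_dist (vstate1 xi_unit) a in
  let mu := joint_dist (vstate1 (vac_norm1 k H)) (yop a xi) in
  Phi nu = mu.
Proof.
move=> nu mu; apply/esym/PhiP.
have muE : 1 + Mseries mu = vac_series a xi.
  apply: ncpsP => -[|i w]; rewrite coefD coef1.
    by rewrite /= addr0 big_nil vstate1 // vac_norm1.
  by rewrite add0r [LHS]joint_distE.
have nuE : 1 + Mseries nu = mixed_series a xi xi.
  apply: ncpsP => -[|i w]; rewrite coefD coef1.
    by rewrite /= addr0 big_nil bop1 -normrE_inner xi_unit expr1n.
  by rewrite add0r [LHS]joint_distE.
have m_eq : 1 + Mseries mu = 1 + (1 + Mseries mu) * Phi_eta nu.
  rewrite {1}muE vac_seriesE mulr_sumr; congr (_ + _).
  by apply: eq_bigr => i _; rewrite embed_seriesE -muE -nuE !mulrA.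
have mU := Mseries_unit mu.
(* With [m = 1 + Mseries mu], cancelling the unit [m] on the left reduces the claim to
   [m - 1 = m * Phi_eta nu]. *)
apply: (mulrI mU); rewrite etaE mulrBr mulr1 divrr //.
by rewrite {1}m_eq addrC addKr.
Qed.
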